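(* Let $n\equiv 1\pmod 4$, $n\ge 2$, $A\ge 1$, $B\ge 1$, $C\ge 1$, $D\ge 0$, and let $u$ be a square-free integer. Then $$T_n(A,B,C,D;u)\le A\,(A+B+C+D)^{o(1)}.$$
   Context: For integers $a,b$ let $\Delta_n(a,b)=(n-1)^{n-1}a^n+n^nb^{n-1}$ (for $n\equiv 1\pmod 4$ this is the discriminant of the trinomial $X^n+aX+b$). $T_n(A,B,C,D;u)$ is the number of pairs of integers $(a,b)\in[C,C+A]\times[D,D+B]$ such that $\Delta_n(a,b)=ur^2$ for some positive integer $r$. $o(1)$ denotes a quantity that, for fixed $n$, tends to $0$ as $A+B+C+D\to\infty$ (uniformly in the other parameters, including $u$). *)

(* Defs.v *)
From HB Require Import structures.
From mathcomp Require Import all_boot all_order all_algebra.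
From mathcomp Require Import finmap.
From mathcomp Require Import boolp classical_sets functions cardinality.
From mathcomp Require Import reals exp.

Set Implicit Arguments.
Unset Strict Implicit.
Unset Printing Implicit Defensive.

Import Order.TTheory GRing.Theory Num.Theory.

Local Open Scope classical_set_scope.
Local Open Scope ring_scope.

(* Negative values are allowed, 1 and -1 are square-free, 0 is not. *)
Definition squarefree (u : int) : Prop :=
  forall d : int, (d ^+ 2 %| u)%Z -> `|d| = 1.

Definition trinomial_disc (n : nat) (a b : int) : int :=
  (n.-1 ^ n.-1)%N%:Z * a ^+ n + (n ^ n)%N%:Z * b ^+ n.-1.

Definition trinomial_set (R : realType) (n : nat) (A B C D : R) (u : int) :
    set (int * int) :=
  [set ab | [/\ C <= ab.1%:~R <= C + A,
                D <= ab.2%:~R <= D + B &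
                exists2 r : int, 0 < r & trinomial_disc n ab.1 ab.2 = u * r ^+ 2]].

Lemma finite_int_itv (R : realType) (x y : R) :
  finite_set [set i : int | x <= i%:~R <= y].
Proof.
pose N := Num.bound (`|x| + `|y|).
have xyN : `|x| + `|y| < N%:R by rewrite archi_boundP// addr_ge0.
apply: (@sub_finite_set _ _
  ((fun k : nat => k%:Z) @` `I_N `|` (fun k : nat => - k%:Z) @` `I_N)); last first.
  by rewrite finite_setU; split; apply: finite_image; exact: finite_II.
move=> i /= /andP[xi iy].
have iN : (`|i|%N < N)%N.
  rewrite -(ltr_nat R) (le_lt_trans _ xyN)// natr_absz intr_norm ler_norml.
  apply/andP; split.
    rewrite (le_trans _ xi)// opprD (le_trans (y := - `|x|))// ?gerDl ?oppr_le0//.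
    by rewrite lerNl -normrN ler_norm.
  by rewrite (le_trans iy)// (le_trans (ler_norm _))// lerDr.
have [i0|i0] := leP 0 i.
- by left; exists `|i|%N => //; rewrite gez0_abs.
- by right; exists `|i|%N => //; rewrite lez0_abs ?opprK// ltW.
Qed.

(* [fset_set] sends infinite sets to [fset0]; this case does not occur in
   [T_] below. *)
Lemma finite_trinomial_set (R : realType) (n : nat) (A B C D : R) (u : int) :
  finite_set (trinomial_set n A B C D u).
Proof.
apply: (@sub_finite_set _ _
  ([set i : int | C <= i%:~R <= C + A] `*` [set i : int | D <= i%:~R <= D + B])).
  by move=> [a b] /= [].
by apply: finite_setX; exact: finite_int_itv.
Qed.

Definition T_ (R : realType) (n : nat) (A B C D : R) (u : int) : nat :=
  #|` fset_set (trinomial_set n A B C D u)|.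

Definition in_range (R : realType) (A B C D : R) (u : int) : Prop :=
  [/\ 1 <= A, 1 <= B, 1 <= C, 0 <= D & squarefree u].

(* The limit is uniform: the threshold [S] depends on [e] only. *)
Definition uniform_o1 (R : realType) (eta : R -> R -> R -> R -> int -> R) : Prop :=
  forall e : R, 0 < e -> exists S : R, forall (A B C D : R) (u : int),
    in_range A B C D u -> S <= A + B + C + D -> `|eta A B C D u| <= e.

(* Main.v *)
Require Import Defs.
From mathcomp Require Import all_boot all_order all_algebra.
From mathcomp Require Import finmap boolp classical_sets functions cardinality.
From mathcomp Require Import reals exp.
From mathcomp Require Import zify ring lra.

(** The bound holds for each [a] separately: there are at most [3 A] integers
    [a] in the range, and for each of them the number of [b] is
    [S ^ o(1)], where [S = A + B + C + D]. Write [n = 2 m + 1] and multiply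
    the equation by [u]. With [x = u r] and [y = (n b) ^ m] it becomes the
    Pell equation [x ^ 2 = d y ^ 2 + M], where [d = n u] and
    [M = u (n - 1) ^ (n - 1) a ^ n > 0] ([trinomial_fiber_bound]). If a solution exists
    at all then [u], [M] and [x] are at most polynomial in [S].

    A Pell equation has few solutions in a box. Dividing out the gcd costs a
    factor tau(M) ([size_solutions]). A primitive solution determines a square
    root [x / y] of [d] modulo [M], and there are at most [4 n tau(M)] such
    roots ([size_sqrt_mod]); this is where the square-freeness of [u] makes
    the bound uniform, since otherwise a square factor common to [d] and [M]
    could produce many roots. Two distinct solutions with the same root differ
    by a nontrivial unit of norm 1 in Z[sqrt d], so their [x] differ by a
    factor at least 2 ([pell_gap]), and a root accounts for only
    logarithmically many solutions.

    Altogether a fibre has at most [tau(M) ^ 2 * 4 n * (1 + log2 x)] elements.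
    The divisor bound is used as [tau(M) ^ k <= c_k M] ([divisor_bound]), so the
    [k]-th power of the size of a fibre is at most a constant times a power of
    [S] whose exponent is independent of [k]. As [k] is arbitrary, this gives
    [c_e S ^ e] for every [e > 0] ([T_le_powR]), and the exponent of the
    theorem is the logarithm to base [S] of the number of pairs divided by
    [A]. *)

Set Implicit Arguments.
Unset Strict Implicit.
Unset Printing Implicit Defensive.

Import Order.TTheory GRing.Theory Num.Theory.
Local Open Scope nat_scope.

(** * Counting by fibres *)

Lemma size_fibers (T U : eqType) (f : T -> U) (s : seq T) (K : seq U) :
  {in s, forall x, f x \in K} ->
  size s <= \sum_(k <- K) size [seq x <- s | f x == k].
Proof.
elim: s => [|x s IHs] fK; first by [].
have {}IHs : size s <= \sum_(k <- K) size [seq y <- s | f y == k].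
  by apply: IHs => y ys; apply: fK; rewrite inE ys orbT.
have fxK : 0 < \sum_(k <- K) (f x == k).
  by rewrite (big_rem (f x)) ?fK ?mem_head//= eqxx.
rewrite (leq_trans (leq_add fxK IHs))// -big_split/=.
by apply: leq_sum => k _; case: (f x == k).
Qed.

Lemma size_fibers_le (T U : eqType) (f : T -> U) (s : seq T) (K : seq U) B :
  {in s, forall x, f x \in K} ->
  (forall k, k \in K -> size [seq x <- s | f x == k] <= B) ->
  size s <= size K * B.
Proof.
move=> /size_fibers /leq_trans leB fB; apply: leB.
rewrite big_seq; apply: leq_trans (_ : _ <= \sum_(k <- K | k \in K) B) _.
  exact: leq_sum.
by rewrite -big_seq big_const_seq count_predT iter_addn_0 mulnC.
Qed.

Lemma size_subsingleton (T : eqType) (s : seq T) :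
  uniq s -> {in s &, forall x y, x = y} -> size s <= 1.
Proof.
case: s => [|x [|y s]]//= /andP[xys _] eqs.
by move: xys; rewrite (eqs x y) ?inE ?eqxx ?orbT.
Qed.

(** * The divisor bound *)

(** A power of an exponent is dominated by an exponential of base 2, with an
    explicit constant: writing [e = k q + r] with [r < k], one has
    [e + 1 <= k (q + 1) <= k 2 ^ q]. It serves both for the multiplicities in
    a prime factorization and for a logarithm. *)
Lemma exp_succ_le k e : 0 < k -> e.+1 ^ k <= k ^ k * 2 ^ e.
Proof.
move=> k0; have e_le : e.+1 <= k * 2 ^ (e %/ k).
  by rewrite (leq_trans (ltn_ceil e k0))// mulnC leq_mul2l ltn_expl ?orbT.
rewrite (@leq_trans ((k * 2 ^ (e %/ k)) ^ k)) ?leq_exp2r//.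
by rewrite expnMn leq_mul2l -expnM leq_exp2l ?leq_divM ?orbT.
Qed.

Lemma size_divisors m :
  size (divisors m) = \prod_(f <- prime_decomp m) f.2.+1.
Proof.
rewrite /divisors; elim: prime_decomp => [|[p e] fs IHfs]; first by rewrite big_nil.
rewrite big_cons -IHfs /=; elim: e => [|e IHe]; first by rewrite mul1n.
by rewrite /= size_merge size_cat size_map IHe [RHS]mulSn addnC.
Qed.

(** This is the bound tau(m) = m ^ o(1), in the form [tau(m) ^ k <= c_k m].
    In the product over [p ^ e] exactly dividing [m], a prime [p >= 2 ^ k]
    satisfies [(e + 1) ^ k <= (2 ^ e) ^ k <= p ^ e]; each of the remaining
    primes costs at most a factor [k ^ k], and there are fewer than [2 ^ k] of
    them, independently of [m]. *)
Lemma divisor_bound k : 0 < k ->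
  exists2 c, 0 < c & forall m, 0 < m -> size (divisors m) ^ k <= c * m.
Proof.
move=> k0; have kk0 : 0 < k ^ k by rewrite expn_gt0 k0.
exists ((k ^ k) ^ 2 ^ k) => [|m m0]; first by rewrite expn_gt0 kk0.
pose c p := if p < 2 ^ k then k ^ k else 1.
have c_prod : \prod_(f <- prime_decomp m) c f.1 <= (k ^ k) ^ 2 ^ k.
  rewrite -(big_map fst xpredT c) -/(primes m) /c -big_mkcond big_const_seq.
  rewrite iter_muln_1 leq_pexp2l// -size_filter -[leqRHS](size_iota 0).
  apply: uniq_leq_size; first by rewrite filter_uniq ?primes_uniq.
  by move=> p; rewrite mem_filter mem_iota => /andP[].
rewrite size_divisors (big_morph (expn^~ k) (fun x y => expnMn x y k) (exp1n k)).
rewrite {2}(prod_prime_decomp m0); apply: leq_trans (leq_mul c_prod (leqnn _)).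
rewrite -big_split/= big_seq [leqRHS]big_seq; apply: leq_prod => -[p e].
move=> /mem_prime_decomp[/prime_gt1 p1 e0 _]; rewrite /c /=.
case: ltnP => [_|le_p].
  rewrite (leq_trans (exp_succ_le e k0))// leq_mul2l leq_exp2r//.
  by rewrite p1 orbT.
rewrite mul1n; apply: leq_trans (_ : (2 ^ e) ^ k <= _).
  by rewrite leq_exp2r// ltn_expl.
by rewrite -expnM mulnC expnM leq_exp2r.
Qed.

(** * Solutions of x^2 = d y^2 + M *)

(** The congruence makes the quotient of [x2 + y2 sqrt d] by
    [x1 + y1 sqrt d] an element [P + Q sqrt d] of norm 1 with integers [P] and
    [Q], and exchanging the two solutions changes the sign of [Q]. If [Q > 0]
    then [P ^ 2 = 1 + d Q ^ 2] forces [P >= 2], whence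
    [x2 = P x1 + d Q y1 >= 2 x1]; if [Q = 0] the two primitive solutions are
    proportional, hence equal. So one class contains at most one solution with
    a given binary logarithm of [x]. When [d] is a perfect square, only the
    case [Q = 0] occurs. *)
Lemma pell_gap d M x1 y1 x2 y2 : 0 < d -> 0 < M ->
  x1 ^ 2 = d * y1 ^ 2 + M -> x2 ^ 2 = d * y2 ^ 2 + M ->
  coprime x1 y1 -> coprime x2 y2 -> x1 * y2 = x2 * y1 %[mod M] ->
  trunc_log 2 x1 = trunc_log 2 x2 -> (x1, y1) = (x2, y2).
Proof.
move=> d0 M0.
wlog le12 : x1 y1 x2 y2 / x2 * y1 <= x1 * y2.
  move=> IH e1 e2 c1 c2 m12 l12; case: (leqP (x2 * y1) (x1 * y2)) => [|/ltnW] le.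
    exact: IH.
  by apply/esym/IH.
move=> e1 e2 c1 c2 /eqP; rewrite eqn_mod_dvd// => /dvdnP[Q eQ] l12.
(* [P'] is [M * P], the rational part of the product of [x2 + y2 sqrt d] with
   the conjugate of [x1 + y1 sqrt d]. *)
have le_dyx : d * y1 * y2 <= x1 * x2.
  rewrite -leq_sqr !expnMn e1 e2; nia.
pose P' := x1 * x2 - d * y1 * y2.
have eP' : x1 * x2 = d * y1 * y2 + P' by rewrite subnKC.
have {}eQ : x1 * y2 = x2 * y1 + Q * M by rewrite -eQ subnKC.
(* Multiplicativity of the norm x^2 - d y^2. *)
have norm' : P' ^ 2 = M ^ 2 * (1 + d * Q ^ 2).
  have eP'z : (P'%:Z = x1%:Z * x2%:Z - d%:Z * y1%:Z * y2%:Z)%R by lia.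
  have eQz : (Q%:Z * M%:Z = x1%:Z * y2%:Z - x2%:Z * y1%:Z)%R by lia.
  have e1z : (M%:Z = x1%:Z ^+ 2 - d%:Z * y1%:Z ^+ 2)%R by lia.
  have e2z : (M%:Z = x2%:Z ^+ 2 - d%:Z * y2%:Z ^+ 2)%R by lia.
  suff : (P'%:Z ^+ 2 - d%:Z * (Q%:Z * M%:Z) ^+ 2 = M%:Z * M%:Z)%R.
    by rewrite !expr2 -!mulnn => ?; lia.
  by rewrite eQz eP'z {1}e1z e2z; ring.
(* The norm is divisible by [M ^ 2] and [Q] is known to be integral, so [P] is
   integral too. *)
have /dvdnP[P eP] : M %| P'.
  by rewrite -(@dvdn_pexp2r _ _ 2)// norm' dvdn_mulr.
have norm : P ^ 2 = 1 + d * Q ^ 2.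
  apply/eqP; rewrite -(@eqn_pmul2l (M ^ 2)) ?expn_gt0 ?M0//.
  by rewrite -norm' eP expnMn mulnC.
have x10 : 0 < x1.
  by rewrite -(@ltn_exp2r 0 x1 2)// e1 exp0n// addn_gt0 M0 orbT.
case: (posnP Q) => [Q0|Q0]; last first.
  have P2 : 2 <= P.
    by rewrite -(@ltn_exp2r 1 P 2)// norm add1n ltnS muln_gt0 d0 expn_gt0 Q0.
  have ex2 : M * x2 = M * (P * x1 + d * Q * y1).
    suff : (M%:Z * x2%:Z = M%:Z * (P%:Z * x1%:Z + d%:Z * Q%:Z * y1%:Z))%R.
      by move=> ?; lia.
    have ePz : (P%:Z * M%:Z = x1%:Z * x2%:Z - d%:Z * y1%:Z * y2%:Z)%R by lia.
    have eQz : (Q%:Z * M%:Z = x1%:Z * y2%:Z - x2%:Z * y1%:Z)%R by lia.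
    have e1z : (M%:Z = x1%:Z ^+ 2 - d%:Z * y1%:Z ^+ 2)%R by lia.
    transitivity (((P%:Z * M%:Z) * x1%:Z + d%:Z * (Q%:Z * M%:Z) * y1%:Z))%R; last by ring.
    by rewrite ePz eQz e1z; ring.
  have {}ex2 : x2 = P * x1 + d * Q * y1.
    by apply/eqP; rewrite -(eqn_pmul2l M0) ex2.
  have : x1.*2 <= x2 by rewrite -mul2n ex2 (leq_trans (leq_mul P2 (leqnn x1)))// leq_addr.
  by move/(leq_trunc_log 2); rewrite trunc_log2_double// -l12 ltnn.
have {}eQ : x1 * y2 = x2 * y1 by rewrite eQ Q0 mul0n addn0.
have ex : x1 = x2.
  apply/eqP; rewrite eqn_dvd -(Gauss_dvdl x2 c1) -eQ dvdn_mulr//=.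
  by rewrite -(Gauss_dvdl x1 c2) eQ dvdn_mulr.
by congr pair => //; apply/esym/eqP; rewrite -(eqn_pmul2l x10) eQ ex.
Qed.

(** After division by the common factor of [h] and [c], the rest of [h] has a
    square dividing [u]. *)
Lemma sqr_dvd_squarefree h c u : 0 < c ->
  (forall d, d ^ 2 %| u -> d = 1) -> h ^ 2 %| c * u -> h %| c.
Proof.
move=> c0 sqf; have g0 : 0 < gcdn h c by rewrite gcdn_gt0 c0 orbT.
have /dvdnP[w ec] := dvdn_gcdr h c; have /dvdnP[k eh] := dvdn_gcdl h c.
have cop : coprime k w.
  by rewrite /coprime -(eqn_pmul2r g0) muln_gcdl -eh -ec mul1n.
have gc : gcdn h c %| c by exact: dvdn_gcdr.
move: (gcdn h c) g0 ec eh gc => g g0 -> -> gc.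
have -> : (k * g) ^ 2 = g * (k ^ 2 * g) by ring.
rewrite [w * g]mulnC -mulnA dvdn_pmul2l//.
move=> /(dvdn_trans (dvdn_mulr _ (dvdnn _))).
by rewrite Gauss_dvdr ?coprimeXl// => /sqf ->; rewrite mul1n dvdn_mulr.
Qed.

Lemma eqn_mod_dist d a b : (a == b %[mod d]) = (d %| (a - b) + (b - a)).
Proof.
have [ab|/ltnW ab] := leqP a b.
  by rewrite eq_sym eqn_mod_dvd// (eqP ab).
by rewrite eqn_mod_dvd// (eqP ab) addn0.
Qed.

Lemma dvdn_mul_div_gcd m a b : 0 < m -> m %| a * b -> m %/ gcdn a m %| b.
Proof.
move=> m0 mab; rewrite dvdn_divLR ?gcdn_gt0 ?m0 ?orbT ?dvdn_gcdr//.
by rewrite mulnC muln_gcdl dvdn_gcd mab dvdn_mulr.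
Qed.

(** The bound is uniform in [u], although [m] may share many factors with it.
    Fix one root [t0]. For any other root [t], [m] divides
    [(t - t0) (t + t0)]; with [g := gcd (t - t0, m)], [t] is then determined
    modulo [g] (as [t0]) and modulo [m / g] (as [- t0]), hence modulo their
    lcm [L]. This leaves [m / L = gcd (g, m / g) =: h] possible values of [t].
    Since [h] divides both [t - t0] and [t + t0], it divides [2 t0], and as
    [h ^ 2] divides [m] it follows that [h ^ 2] divides [4 n u], so that [h]
    divides [4 n] because [u] is square-free. *)
Lemma size_sqrt_mod n u m (s : seq nat) : 0 < n -> 0 < m ->
  (forall d, d ^ 2 %| u -> d = 1) -> uniq s ->
  {in s, forall t, t < m /\ t ^ 2 = n * u %[mod m]} ->
  size s <= size (divisors m) * (4 * n).
Proof.
move=> n0 m0 sqf us sP; case: s us sP => // t0 s0; set s := t0 :: s0 => us sP.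
have [lt0 et0] : t0 < m /\ t0 ^ 2 = n * u %[mod m] by apply: sP; rewrite mem_head.
pose dist t := (t - t0) + (t0 - t).
apply: (@size_fibers_le _ _ (fun t => gcdn (dist t) m)) => [t ts|g _].
  by rewrite -dvdn_divisors// dvdn_gcdr.
set s' := [seq _ <- _ | _].
have s'P t : t \in s' -> [/\ t \in s, t = t0 %[mod g] & m %/ g %| t + t0].
  rewrite mem_filter => /andP[/eqP <- ts]; split=> //.
    by apply/eqP; rewrite eqn_mod_dist dvdn_gcdl.
  apply: dvdn_mul_div_gcd => //.
  have [_ et] := sP t ts.
  have : t ^ 2 == t0 ^ 2 %[mod m] by rewrite et et0.
  by rewrite eqn_mod_dist !subn_sqr /dist mulnDl [t0 + t]addnC.
case es' : s' => [//|t1 s1]; rewrite -es'.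
have t1s' : t1 \in s' by rewrite es' mem_head.
have gm : g %| m by move: t1s'; rewrite mem_filter => /andP[/eqP <- _]; apply: dvdn_gcdr.
have g0 : 0 < g by rewrite (dvdn_gt0 m0 gm).
pose L := lcmn g (m %/ g); pose h := gcdn g (m %/ g).
have Lh : L * h = m by rewrite muln_lcm_gcd mulnC divnK.
have /andP[L0 h0] : (0 < L) && (0 < h) by rewrite -muln_gt0 Lh.
have h4n : h <= 4 * n.
  apply: dvdn_leq; first by rewrite muln_gt0.
  apply: (@sqr_dvd_squarefree _ _ u) => //; first by rewrite muln_gt0.
  have [_ e1 e2] := s'P _ t1s'.
  have h2m : h ^ 2 %| m by rewrite -(divnK gm) mulnC dvdn_mul ?dvdn_gcdl ?dvdn_gcdr.
  have h2t : h %| 2 * t0.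
    have : h %| t1 + t0 by rewrite (dvdn_trans (dvdn_gcdr _ _) e2).
    rewrite mul2n -addnn /dvdn -modnDml.
    suff -> : t1 = t0 %[mod h] by rewrite modnDml.
    by apply/eqP; rewrite eqn_mod_dist (dvdn_trans (dvdn_gcdl _ _))// -eqn_mod_dist e1.
  have : h ^ 2 %| 4 * t0 ^ 2 by rewrite -(expnMn 2 t0 2) dvdn_exp2r.
  have : t0 ^ 2 = n * u %[mod h ^ 2].
    by apply/eqP; rewrite eqn_mod_dist (dvdn_trans h2m)// -eqn_mod_dist et0.
  by move=> e; rewrite /dvdn -modnMmr e modnMmr mulnA.
rewrite -(size_map (divn^~ L)) -[leqRHS](size_iota 0); apply: uniq_leq_size.
  rewrite map_inj_in_uniq ?filter_uniq// => t t' /s'P[_ e1 e2] /s'P[_ e1' e2'] eL.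
  rewrite (divn_eq t L) (divn_eq t' L) eL; congr (_ + _); apply/eqP.
  rewrite eqn_mod_dist dvdn_lcm -!eqn_mod_dist e1 e1' eqxx/=.
  by rewrite -(eqn_modDr t0) (eqP e2) (eqP e2').
move=> _ /mapP[t /s'P[/sP[tm _] _ _] ->]; rewrite mem_iota leq0n add0n /=.
by rewrite (leq_trans _ h4n)// ltn_divLR// mulnC Lh.
Qed.

(** For [y = 0], outside the domain of the Bezout specification, coprimality
    forces [M = 1]. *)
Lemma egcdn_inv y M : coprime y M -> y * (egcdn y M).1 = 1 %[mod M].
Proof.
case: (posnP y) => [->|y0 /eqP yM].
  by rewrite /coprime gcd0n => /eqP ->; rewrite !modn1.
by case: egcdnP => //= i j e _; rewrite mulnC e yM modnMDl.
Qed.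

(** A primitive solution has [y] invertible modulo [M], and [x / y] is a square
    root of [n u] modulo [M]. Solutions with the same root satisfy the congruence
    of [pell_gap], so within a root the binary logarithm of [x] is injective. *)
Lemma size_primitive_solutions n u M K (s : seq (nat * nat)) :
  0 < n -> 0 < u -> 0 < M -> (forall d, d ^ 2 %| u -> d = 1) -> uniq s ->
  {in s, forall p, [/\ p.1 ^ 2 = n * u * p.2 ^ 2 + M, coprime p.1 p.2 &
                       trunc_log 2 p.1 <= K]} ->
  size s <= size (divisors M) * (4 * n) * K.+1.
Proof.
move=> n0 u0 M0 sqf us sP.
(* [t p] is the residue of [x / y] modulo [M]. *)
pose inv y := (egcdn y M).1; pose t (p : nat * nat) := (p.1 * inv p.2) %% M.
have invP p : p \in s -> p.2 * inv p.2 = 1 %[mod M].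
  move=> /sP[e cop _]; apply: egcdn_inv; rewrite coprime_sym in cop.
  have : coprime p.2 (p.1 ^ 2) by rewrite coprimeXr.
  by rewrite e -mulnn mulnA /coprime gcdnMDl.
have tP p : p \in s -> p.1 = t p * p.2 %[mod M].
  move=> /invP e; rewrite modnMml -mulnA [inv _ * _]mulnC -modnMmr e.
  by rewrite modnMmr muln1.
have t2 p : p \in s -> t p ^ 2 = n * u %[mod M].
  move=> ps; have [e _ _] := sP p ps; have ei := invP p ps.
  rewrite modnXm expnMn e mulnDl [M * _]mulnC addnC modnMDl -mulnA -expnMn.
  by rewrite -modnMmr -modnXm ei modnXm exp1n modnMmr muln1.
rewrite (@leq_trans (size (undup (map t s)) * K.+1))//; last first.
  rewrite leq_mul2r (@size_sqrt_mod n u) ?orbT ?undup_uniq//.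
  move=> _ /[!mem_undup] /mapP[p ps ->].
  by rewrite ltn_mod t2.
apply: (@size_fibers_le _ _ t) => [p ps|r _]; first by rewrite mem_undup map_f.
rewrite -[K.+1]muln1 -(size_iota 0 K.+1).
apply: (@size_fibers_le _ _ (fun p => trunc_log 2 p.1)) => [p|l _].
  by rewrite mem_filter mem_iota => /andP[_ /sP[]].
apply: size_subsingleton; first by rewrite !filter_uniq.
move=> [x1 y1] [x2 y2]; rewrite !mem_filter.
move=> /and3P[/eqP l1 /eqP tr1 s1] /and3P[/eqP l2 /eqP tr2 s2].
have [/= e1 c1 _] := sP _ s1; have [/= e2 c2 _] := sP _ s2.
apply: (pell_gap _ M0 e1 e2) => //; first by rewrite muln_gt0 n0.
  have /= m1 := tP _ s1; have /= m2 := tP _ s2.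
  by rewrite -modnMml m1 tr1 -[RHS]modnMml m2 tr2 !modnMml mulnAC.
by rewrite l1 l2.
Qed.

(** The square of the gcd of a solution divides [M]; dividing it out leaves a
    primitive solution for a divisor of [M]. Hence the second divisor factor. *)
Lemma size_solutions n u M K (s : seq (nat * nat)) :
  0 < n -> 0 < u -> 0 < M -> (forall d, d ^ 2 %| u -> d = 1) -> uniq s ->
  {in s, forall p, p.1 ^ 2 = n * u * p.2 ^ 2 + M /\ trunc_log 2 p.1 <= K} ->
  size s <= size (divisors M) ^ 2 * (4 * n) * K.+1.
Proof.
move=> n0 u0 M0 sqf us sP.
have x0 p : p \in s -> 0 < p.1.
  by move=> /sP[e _]; rewrite -(@ltn_exp2r 0 p.1 2)// e exp0n// addn_gt0 M0 orbT.
have g2M p : p \in s -> gcdn p.1 p.2 ^ 2 %| M.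
  move=> /sP[e _].
  have gy : gcdn p.1 p.2 ^ 2 %| n * u * p.2 ^ 2.
    by rewrite dvdn_mull// dvdn_exp2r// dvdn_gcdr.
  by rewrite -(dvdn_addr _ gy) -e dvdn_exp2r// dvdn_gcdl.
rewrite -mulnn -!mulnA.
apply: (@size_fibers_le _ _ (fun p => gcdn p.1 p.2)) => [p ps|g _].
  by rewrite -dvdn_divisors// (dvdn_trans _ (g2M p ps))// dvdn_exp.
set s' := [seq _ <- _ | _].
have s'P p : p \in s' -> p \in s /\ exists x y, p = (x * g, y * g).
  rewrite mem_filter => /andP[/eqP <- ps]; split=> //.
  by exists (p.1 %/ gcdn p.1 p.2), (p.2 %/ gcdn p.1 p.2);
    rewrite !divnK ?dvdn_gcdl ?dvdn_gcdr//; case: (p).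
case es' : s' => [//|p1 s1]; rewrite -es'.
have p1s' : p1 \in s' by rewrite es' mem_head.
have [g0 gM] : 0 < g /\ g ^ 2 %| M.
  move: p1s'; rewrite mem_filter => /andP[/eqP <- ps].
  by rewrite gcdn_gt0 x0//= g2M.
have Mg0 : 0 < M %/ g ^ 2 by rewrite divn_gt0 ?expn_gt0 ?g0// dvdn_leq.
rewrite (@leq_trans (size (divisors (M %/ g ^ 2)) * (4 * n) * K.+1))//; last first.
  rewrite -!mulnA leq_mul//; apply: uniq_leq_size => [|e]; first exact: divisors_uniq.
  rewrite -!dvdn_divisors// => /dvdn_trans; apply.
  by rewrite -{2}(divnK gM) dvdn_mulr.
pose red (p : nat * nat) := (p.1 %/ g, p.2 %/ g).
rewrite -(size_map red); apply: (@size_primitive_solutions n u) => //.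
  rewrite map_inj_in_uniq ?filter_uniq//.
  move=> _ _ /s'P[_ [x [y ->]]] /s'P[_ [x' [y' ->]]].
  by rewrite /red /= !mulnK// => -[-> ->].
move=> _ /mapP[p ps' ->].
have [/sP[e lK] [x [y ep]]] := s'P p ps'.
have : gcdn p.1 p.2 = g by move: ps'; rewrite mem_filter => /andP[/eqP].
move: e lK; rewrite {p ps'}ep /red /= !mulnK// => e lK gE; split.
- apply/eqP; rewrite -(@eqn_pmul2r (g ^ 2)) ?expn_gt0 ?g0// mulnDl divnK//.
  by rewrite -expnMn e expnMn mulnA.
- by rewrite /coprime -(eqn_pmul2r g0) muln_gcdl gE mul1n.
- by rewrite (leq_trans _ lK)// leq_trunc_log// leq_pmulr.
Qed.

Lemma size_solutions_bound n k : 0 < n -> 0 < k ->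
  exists2 c, 0 < c & forall u M Z (s : seq (nat * nat)),
    0 < u -> 0 < M -> 0 < Z -> (forall d, d ^ 2 %| u -> d = 1) -> uniq s ->
    {in s, forall p, p.1 ^ 2 = n * u * p.2 ^ 2 + M /\ p.1 <= Z} ->
    size s ^ k <= c * (M ^ 2 * Z).
Proof.
move=> n0 k0; have [c c0 tauP] := divisor_bound k0.
exists (c ^ 2 * (4 * n) ^ k * k ^ k) => [|u M Z s u0 M0 Z0 sqf us sP].
  by rewrite !muln_gt0 !expn_gt0 c0 muln_gt0 n0 k0.
have sB : size s <= size (divisors M) ^ 2 * (4 * n) * (trunc_log 2 Z).+1.
  apply: (@size_solutions n u) => // p /sP[e pZ].
  by split=> //; apply: leq_trunc_log.
have logB : (trunc_log 2 Z).+1 ^ k <= k ^ k * Z.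
  by rewrite (leq_trans (exp_succ_le _ k0))// leq_mul2l trunc_logP ?orbT.
rewrite -(@leq_exp2r _ _ k) // in sB; apply: (leq_trans sB).
rewrite expnMn [(_ * (4 * n)) ^ k]expnMn expnAC.
rewrite (_ : _ * (M ^ 2 * Z) = (c * M) ^ 2 * (4 * n) ^ k * (k ^ k * Z)).
  by apply: leq_mul logB; apply: leq_mul => //; rewrite leq_sqr tauP.
by rewrite [(c * M) ^ 2]expnMn; ring.
Qed.

(** * The trinomial discriminant *)

(** Since [n] is odd, [n ^ n] is [n] times a square and [n - 1] is even: with
    [n = 2 m + 1], multiplying the equation by [u] turns it into
    [(u r) ^ 2 = n u ((n b) ^ m) ^ 2 + u (n - 1) ^ (n - 1) a ^ n]. For fixed
    [a] this is an equation [x ^ 2 = d y ^ 2 + M] with [M > 0], all of whose data are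
    polynomially bounded as soon as one solution exists: [u] then divides a
    positive discriminant. *)
Lemma trinomial_fiber_bound n k : odd n -> 2 <= n -> 0 < k ->
  exists2 c, 0 < c & forall u a H (s : seq nat),
    0 < u -> (forall d, d ^ 2 %| u -> d = 1) -> 0 < a <= H -> uniq s ->
    {in s, forall b, b <= H /\
       exists r, n.-1 ^ n.-1 * a ^ n + n ^ n * b ^ n.-1 = u * r ^ 2} ->
    size s ^ k <= c * H ^ (5 * n).
Proof.
move=> n_odd n2 k0; have n0 : 0 < n by apply: leq_trans n2.
have [c c0 cP] := size_solutions_bound n0 k0.
exists (c * (2 * n ^ n) ^ 5) => [|u a H s u0 sqf /andP[a0 aH] us sP].
  by rewrite muln_gt0 c0 expn_gt0 muln_gt0 expn_gt0 n0.
case es : s => [|b0 s0]; first by rewrite exp0n.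
rewrite -es; have b0s : b0 \in s by rewrite es mem_head.
have H0 : 0 < H by apply: leq_trans aH.
pose m := n./2; have nE : n = m.*2.+1 by rewrite -[LHS]odd_double_half n_odd.
have m0 : 0 < m by case: (m) nE n2 => // ->.
have n'E : n.-1 = m * 2 by rewrite nE muln2.
(* [W] bounds the discriminant of every pair in the box, hence also [u], [N] and
   [x]; as [M = u N], this gives [M ^ 2 x <= W ^ 5]. *)
pose N := n.-1 ^ n.-1 * a ^ n; pose W := 2 * n ^ n * H ^ n.
have N0 : 0 < N by rewrite muln_gt0 !expn_gt0 a0 n'E muln_gt0 m0.
have NW : N <= n ^ n * H ^ n.
  rewrite leq_mul ?leq_exp2r// (leq_trans (_ : _ <= n ^ n.-1))//.
    by rewrite leq_exp2r ?leq_pred// n'E muln_gt0 m0.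
  by rewrite leq_pexp2l ?leq_pred.
have discW b : b <= H -> N + n ^ n * b ^ n.-1 <= W.
  move=> bH; rewrite /W -mulnA mul2n -addnn leq_add// leq_mul2l; apply/orP; right.
  rewrite (leq_trans (_ : _ <= H ^ n.-1))//.
    by rewrite leq_exp2r// n'E muln_gt0 m0.
  by rewrite leq_pexp2l ?leq_pred.
have W0 : 0 < W by apply: leq_trans (discW 0 isT); rewrite addn_gt0 N0.
have rP b : b \in s -> forall r, N + n ^ n * b ^ n.-1 = u * r ^ 2 -> 0 < r.
  move=> _ r e; rewrite lt0n; apply/eqP => r0.
  by move: N0; rewrite -(ltn_add2r (n ^ n * b ^ n.-1)) e r0 muln0.
have uW : u <= W.
  have [b0H [r er]] := sP _ b0s.
  rewrite (leq_trans _ (discW _ b0H))// er leq_pmulr// expn_gt0.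
  by rewrite (rP _ b0s _ er).
have /choice[r rE] : forall b, exists r, b \in s ->
    N + n ^ n * b ^ n.-1 = u * r ^ 2.
  move=> b; case: (boolP (b \in s)) => [/sP[_ [r er]]|_]; first by exists r.
  by exists 0.
pose f b := (u * r b, (n * b) ^ m).
have f_inj : injective f.
  move=> b b' [_ /eqP]; rewrite eqn_exp2r// => /eqP.
  by move=> /eqP; rewrite eqn_pmul2l// => /eqP.
rewrite -(size_map f); apply: leq_trans (cP u (u * N) W _ _ _ _ _ _ _) _ => //.
- by rewrite muln_gt0 u0.
- by rewrite map_inj_uniq.
- move=> _ /mapP[b bs ->] /=; have [bH _] := sP b bs.
  have eX : (u * r b) ^ 2 = u * (N + n ^ n * b ^ n.-1).
    by rewrite rE// expnMn; ring.
  split.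
    rewrite eX n'E -[X in n ^ X](prednK n0) n'E -expnM expnMn expnS; ring.
  rewrite -leq_sqr eX -mulnn leq_mul// discW//.
- rewrite -mulnA leq_mul2l; apply/orP; right.
  have -> : 5 * n = n * 5 by rewrite mulnC.
  rewrite expnM -expnMn.
  have -> : W ^ 5 = (W * W) ^ 2 * W by ring.
  rewrite leq_mul2r leq_sqr; apply/orP; right.
  by rewrite leq_mul// (leq_trans _ (discW 0 isT))// leq_addr.
Qed.

Local Open Scope ring_scope.

Lemma squarefree_nat (v : nat) :
  squarefree v -> forall d : nat, (d ^ 2 %| v)%N -> d = 1%N.
Proof.
move=> sqf d dv; have : `|d%:Z| = 1 by apply: sqf; rewrite dvdzE abszX !absz_nat.
by rewrite ger0_norm// => -[].
Qed.

(** The positivity of [a] makes the discriminant, and hence [u], positive, so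
    that the problem lives in the natural numbers. *)
Lemma trinomial_setP (R : realType) n (A B C D : R) (u : int) ab :
  (1 < n)%N -> 1 <= C -> 0 <= D -> ab \in trinomial_set n A B C D u ->
  exists a b r v : nat, [/\ ab = (a%:Z, b%:Z) /\ u = v%:Z, (0 < v)%N,
    C <= a%:R <= C + A, D <= b%:R <= D + B &
    (n.-1 ^ n.-1 * a ^ n + n ^ n * b ^ n.-1 = v * r ^ 2)%N].
Proof.
move=> n1 C1 D0; rewrite inE; case: ab => [a b] [/= aC bD [r r0 er]].
have a0 : 0 < a.
  by rewrite -(ltr0z R); apply: lt_le_trans (le_trans C1 _) => //; case/andP: aC.
have b0 : 0 <= b by rewrite -(ler0z R) (le_trans D0)//; case/andP: bD.
case: a b r a0 b0 r0 aC bD er => [a|//] [b|//] [r|//] a0 b0 r0 aC bD er.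
have disc0 : 0 < trinomial_disc n a b.
  rewrite ltr_wpDr// ?mulr_ge0 ?exprn_ge0// mulr_gt0 ?exprn_gt0//.
  by rewrite ltz_nat expn_gt0; case: (n) n1 => [|[]].
have u0 : 0 < u by move: disc0; rewrite er pmulr_lgt0 ?exprn_gt0.
case: u u0 er => [v|//] v0 er; exists a, b, r, v; split=> //.
move/eqP: er; rewrite /trinomial_disc -!natz -!natrX -!natrM -natrD eqr_nat.
by move=> /eqP.
Qed.

Lemma natr_le_powR (R : realType) (N c H q k : nat) (S e : R) :
  (0 < k)%N -> 1 <= S -> H%:R <= S -> q%:R / k%:R <= e ->
  (N ^ k <= c * H ^ q)%N -> N%:R <= c%:R `^ k%:R^-1 * S `^ e.
Proof.
move=> k0 S1 HS qke Nk; have S0 : 0 <= S by apply: le_trans S1.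
have -> : N%:R = (N%:R ^+ k) `^ k%:R^-1 :> R.
  by rewrite -powR_mulrn// -powRrM divff ?powRr1// pnatr_eq0 -lt0n.
apply: (@le_trans _ _ ((c%:R * S ^+ q) `^ k%:R^-1)).
  rewrite ge0_ler_powR ?invr_ge0 ?nnegrE ?exprn_ge0 ?mulr_ge0 ?exprn_ge0//.
  rewrite -natrX (le_trans (y := (c * H ^ q)%:R)) ?ler_nat// natrM natrX.
  by rewrite ler_wpM2l// lerXn2r ?nnegrE.
rewrite powRM ?exprn_ge0// ler_wpM2l ?powR_ge0//.
by rewrite -powR_mulrn// -powRrM ler_powR.
Qed.

(** * Assembling the estimate *)

(** At most [A + 2 <= 3 A] values of [a] occur, and each fibre has at most
    [c S ^ e] points, by [trinomial_fiber_bound] with [k >= 5 n / e]. *)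
Lemma T_le_powR (R : realType) n (e : R) : odd n -> (1 < n)%N -> 0 < e ->
  exists2 c : R, 0 < c & forall (A B C D : R) u, in_range A B C D u ->
    (T_ n A B C D u)%:R <= c * A * (A + B + C + D) `^ e.
Proof.
move=> n_odd n1 e0.
pose k := (Num.truncn ((5 * n)%:R / e)).+1.
have k0 : (0 < k)%N by [].
have qke : (5 * n)%:R / k%:R <= e.
  rewrite ler_pdivrMr ?ltr0n// mulrC -ler_pdivrMr//.
  by rewrite ltW// truncnS_gt.
have [c c0 cP] := trinomial_fiber_bound n_odd n1 k0.
pose c' : R := c%:R `^ k%:R^-1.
have c'0 : 0 < c' by rewrite powR_gt0 ?ltr0n.
exists (3%:R * c') => [|A B C D u [A1 B1 C1 D0 sqf]]; first by rewrite mulr_gt0.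
set S := A + B + C + D.
have S1 : 1 <= S by rewrite /S; lra.
pose H := Num.truncn S.
have HS : H%:R <= S by rewrite truncn_le; lra.
pose s : seq (int * int) := fset_set (trinomial_set n A B C D u).
have us : uniq s by exact: fset_uniq.
have sP ab : ab \in s -> exists a b r v : nat, [/\ ab = (a%:Z, b%:Z) /\ u = v%:Z, (0 < v)%N,
    C <= a%:R <= C + A, D <= b%:R <= D + B &
    (n.-1 ^ n.-1 * a ^ n + n ^ n * b ^ n.-1 = v * r ^ 2)%N].
  rewrite -[ab \in s]/(ab \in fset_set _) in_fset_set; last exact: finite_trinomial_set.
  exact: trinomial_setP.
rewrite /T_ -/s.
pose K := iota (Num.truncn C) (Num.truncn A).+2.
have sK : {in s, forall ab, `|ab.1|%N \in K}.
  move=> _ /sP[a [b [r [v [[-> _] _ /andP[Ca aCA] _ _]]]]]; rewrite mem_iota absz_nat.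
  have C0 : 0 <= C by lra.
  have A0 : 0 <= A by lra.
  have /andP[_ CT] := truncn_itv C0; have /andP[_ AT] := truncn_itv A0.
  rewrite -(ler_nat R) (le_trans _ Ca) ?truncn_le//=.
  rewrite -(ltr_nat R) natrD.
  move: CT AT; rewrite -!natr1; lra.
rewrite (le_trans (y := (size K)%:R * (c' * S `^ e)))//; last first.
  rewrite size_iota (_ : 3%:R * c' * A * _ = 3%:R * A * (c' * S `^ e)); last by ring.
  rewrite ler_wpM2r ?mulr_ge0 ?powR_ge0//.
  have : (Num.truncn A)%:R <= A by rewrite truncn_le; lra.
  rewrite -!natr1; lra.
have := size_fibers sK; rewrite -(ler_nat R) => /le_trans; apply.
rewrite natr_sum -sum1_size natr_sum mulr_suml ler_sum// => a _; rewrite mul1r.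
set sa := [seq _ <- _ | _].
case esa : sa => [|ab0 sa']; first by rewrite mulr_ge0 ?powR_ge0.
rewrite -esa; have ab0sa : ab0 \in sa by rewrite esa mem_head.
apply: (@natr_le_powR _ _ c H (5 * n) k) => //.
have saP ab : ab \in sa -> exists b r v : nat, [/\ ab = (a%:Z, b%:Z) /\ u = v%:Z, (0 < v)%N,
    C <= a%:R <= C + A, D <= b%:R <= D + B &
    (n.-1 ^ n.-1 * a ^ n + n ^ n * b ^ n.-1 = v * r ^ 2)%N].
  rewrite mem_filter => /andP[/eqP ea /sP[a' [b [r [v [[eab eu] v0 aC bD er]]]]]].
  have ea' : a' = a by rewrite -ea eab absz_nat.
  by exists b, r, v; rewrite -ea'.
have [_ [_ [v [[_ eu] v0 /andP[Ca aCA] _ _]]]] := saP _ ab0sa.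
rewrite -(size_map (fun ab : int * int => `|ab.2|%N)).
apply: (cP v a) => //.
- by apply: squarefree_nat; rewrite -eu.
- apply/andP; split; first by rewrite -(ltr_nat R); lra.
  by rewrite truncn_ge_nat ?/S; lra.
- rewrite map_inj_in_uniq ?filter_uniq//.
  move=> _ _ /saP[b [_ [_ [[-> _] _ _ _ _]]]] /saP[b' [_ [_ [[-> _] _ _ _ _]]]].
  by rewrite !absz_nat => ->.
- move=> _ /mapP[_ /saP[b [r [v' [[-> eu'] _ _ /andP[_ bB] er]]]] ->].
  rewrite absz_nat; split; first by rewrite truncn_ge_nat ?/S; lra.
  by exists r; rewrite er; congr (_ * _)%N; move: eu'; rewrite eu => -[].
Qed.

Unset Implicit Arguments.

Theorem theorem1p4 (R : realType) (n : nat)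
    (n_mod4 : (n = 1 %[mod 4])%N) (n_ge2 : (2 <= n)%N) :
  exists2 eta : R -> R -> R -> R -> int -> R,
    uniform_o1 eta &
    forall (A B C D : R) (u : int),
      1 <= A -> 1 <= B -> 1 <= C -> 0 <= D -> squarefree u ->
      (T_ n A B C D u)%:R <= A * (A + B + C + D) `^ eta A B C D u.
Proof.
have n_odd : odd n.
  by rewrite -[odd n](oddb) -modn2 -(@modn_dvdm 4)// n_mod4.
pose eta (A B C D : R) u :=
  Num.max 0 (ln ((T_ n A B C D u)%:R / A) / ln (A + B + C + D)).
(* [eta] is the least nonnegative exponent for which the bound holds; since
   [ln 0 = 0], it is 0 when there is nothing to count. *)
exists eta => [e e0|A B C D u A1 B1 C1 D0 sqf]; last first.
  have [T0|T0] := posnP (T_ n A B C D u).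
    by rewrite T0 mulr_ge0 ?powR_ge0// (le_trans _ A1).
  have A0 : 0 < A by lra.
  have lnS0 : 0 < ln (A + B + C + D) by rewrite ln_gt0//; lra.
  rewrite mulrC -ler_pdivrMr//.
  set x := _ / A; have x0 : 0 < x by rewrite divr_gt0 ?ltr0n.
  apply: (@le_trans _ _ ((A + B + C + D) `^ (ln x / ln (A + B + C + D)))).
    by rewrite /powR gt_eqF ?divfK ?lnK ?gt_eqF//; lra.
  by rewrite ler_powR ?le_max ?lexx ?orbT//; lra.
have e20 : 0 < e / 2%:R by rewrite divr_gt0.
have [c c0 cP] := T_le_powR n_odd n_ge2 e20.
(* Beyond this threshold the constant [c] is absorbed by [S `^ (e / 2)]. *)
exists (c `^ (e / 2%:R)^-1) => A B C D u rangeABCD.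
have := cP _ _ _ _ _ rangeABCD; case: rangeABCD => A1 B1 C1 D0 sqf.
set S := A + B + C + D => TB cS.
have S1 : 1 < S by rewrite /S; lra.
have S0 : 0 < S by lra.
have A0 : 0 < A by lra.
rewrite /eta ger0_norm ?le_max ?lexx// ge_max (ltW e0)/=.
rewrite ler_pdivrMr ?ln_gt0//.
have [T0|T0] := posnP (T_ n A B C D u).
  by rewrite T0 mul0r ln0// mulr_ge0 ?ln_ge0 ?(ltW e0) ?(ltW S1).
rewrite -ln_powR ler_ln ?posrE ?powR_gt0 ?divr_gt0 ?ltr0n//.
rewrite ler_pdivrMr// (le_trans TB)//.
have -> : S `^ e = S `^ (e / 2%:R) * S `^ (e / 2%:R).
  by rewrite -powRD ?(gt_eqF S0) ?implybT//; congr (_ `^ _); lra.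
rewrite mulrAC ler_wpM2r ?(ltW A0)// ler_wpM2r ?powR_ge0//.
have := ge0_ler_powR (ltW e20) _ _ cS.
rewrite !nnegrE powR_ge0 (ltW S0) -powRrM mulVf ?gt_eqF// powRr1 ?(ltW c0)//.
exact.
Qed.
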